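(* Let $L$ be a finite-dimensional $n$-step nilpotent Lie superalgebra over a field $\mathbb{F}$ with nilpotency index $n\geq 3$. If there exists a non-trivial superderivation $D\in\operatorname{Der}(L)$ such that $D(L^1)\subseteq Z(L)$, then $L$ admits pure local superderivations, i.e. there exists a local superderivation of $L$ that is not a superderivation of $L$.
   Context: A Lie superalgebra over $\mathbb{F}$ is a $\mathbb{Z}_2$-graded vector space $L=L_{\bar 0}\oplus L_{\bar 1}$ with a bilinear bracket satisfying $[L_\alpha,L_\beta]\subseteq L_{\alpha+\beta}$ and, for all $x\in L_\alpha$, $y\in L_\beta$, $z\in L$ with $\alpha,\beta\in\mathbb{Z}_2$ (in the first identity $x,y$ are homogeneous of degrees $|x|=\alpha$, $|y|=\beta$), $[x,y]=-(-1)^{|x||y|}[y,x]$ and $[x,[y,z]]=[[x,y],z]+(-1)^{|x||y|}[y,[x,z]]$. Lower central series: $L^0=L$, $L^1=[L,L]$, $L^k=[L,L^{k-1}]$ for $k\geq 1$. $L$ is nilpotent if $L^n=0$ for some positive integer $n$; the smallest such positive integer $n$ is the nilpotency index, and $L$ is then called $n$-step nilpotent. The center is $Z(L)=\{x\in L\mid [x,y]=0 \text{ for all } y\in L\}$. A linear map $D:L\to L$ that is homogeneous of degree $|D|=\alpha\in\mathbb{Z}_2$ (i.e. $D(L_\beta)\subseteq L_{\alpha+\beta}$) is a superderivation of degree $\alpha$ if $D([x,y])=[D(x),y]+(-1)^{|D||x|}[x,D(y)]$ for all homogeneous $x\in L$ and all $y\in L$. Let $\operatorname{Der}_\alpha(L)$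 be the set of these, and $\operatorname{Der}(L)=\operatorname{Der}_{\bar 0}(L)\oplus\operatorname{Der}_{\bar 1}(L)$; the elements of $\operatorname{Der}(L)$ are the superderivations of $L$. A superderivation $D$ is trivial if $D(x)=0$ for all $x\in L$, and non-trivial otherwise. A linear map $\Delta:L\to L$ is a local superderivation if for every $x\in L$ there is a superderivation $D_x\in\operatorname{Der}(L)$ (depending on $x$) with $\Delta(x)=D_x(x)$. A pure local superderivation is a local superderivation that is not a superderivation. *)

(* Defs.v *)
From mathcomp Require Import all_boot all_order all_algebra.

Set Implicit Arguments.
Unset Strict Implicit.
Unset Printing Implicit Defensive.

Import GRing.Theory.
Local Open Scope ring_scope.

(* In signs, degrees in 'Z_2 are multiplied through their representatives in
   {0, 1}.  F is arbitrary: in characteristic 2 or 3 the extra axioms some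
   authors impose ([x, x] = 0 for x even, [x, [x, x]] = 0 for x odd) are not
   required.                                                                 *)
Record lieSuperalgebra (F : fieldType) := LieSuperalgebra {
  lsa_sort :> vectType F;
  part : 'Z_2 -> {vspace lsa_sort};
  bracket : {bilinear lsa_sort -> lsa_sort -> lsa_sort};
  part_sum : (part 0%R + part 1%R)%VS = fullv;
  part_cap : (part 0%R :&: part 1%R)%VS = 0%VS;
  bracket_part : forall a b x y,
    x \in part a -> y \in part b -> bracket x y \in part (a + b);
  bracket_skew : forall a b x y,
    x \in part a -> y \in part b ->
    bracket x y = - ((-1) ^+ (a * b)%N *: bracket y x);
  bracket_jacobi : forall a b x y z,
    x \in part a -> y \in part b ->
    bracket x (bracket y z) =
      bracket (bracket x y) z + (-1) ^+ (a * b)%N *: bracket y (bracket x z)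
}.

Section LieSuperalgebraTheory.

Variables (F : fieldType) (L : lieSuperalgebra F).

(* The span of all [u, v] with u in U and v in V, computed on bases; see
   bracketv_subP.                                                             *)
Definition bracketv (U V : {vspace L}) : {vspace L} :=
  <<[seq bracket L u v | u <- vbasis U, v <- vbasis V]>>%VS.

Lemma memv_bracket (U V : {vspace L}) u v :
  u \in U -> v \in V -> bracket L u v \in bracketv U V.
Proof.
move=> /coord_vbasis -> /coord_vbasis ->.
rewrite linear_sumlz; apply: memv_suml => i _.
rewrite linear_sumr; apply: memv_suml => j _.
rewrite linearZl_LR linearZr_LR /=; do 2!apply: memvZ.
by apply: memv_span; apply: allpairs_f; apply: mem_nth; rewrite size_tuple.
Qed.

Lemma bracketv_subP (U V W : {vspace L}) :
  reflect (forall u v, u \in U -> v \in V -> bracket L u v \in W)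
          (bracketv U V <= W)%VS.
Proof.
apply: (iffP idP) => [sUVW u v Uu Vv | UVW].
  exact: subvP sUVW _ (memv_bracket Uu Vv).
apply/span_subvP => _ /allpairsP[[u v] /= [Uu Vv ->]].
exact: UVW (vbasis_mem Uu) (vbasis_mem Vv).
Qed.

Fixpoint lcs (k : nat) : {vspace L} :=
  if k is k'.+1 then bracketv fullv (lcs k') else fullv.

Definition step_nilpotent (n : nat) : Prop :=
  [/\ (0 < n)%N, lcs n = 0%VS
    & forall m, (0 < m)%N -> lcs m = 0%VS -> (n <= m)%N].

Definition central (x : L) : Prop := forall y, bracket L x y = 0.

Definition superderivation_deg (a : 'Z_2) (D : 'End(L)) : Prop :=
  (forall b x, x \in part L b -> D x \in part L (a + b)) /\
  (forall b x y, x \in part L b ->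
     D (bracket L x y) =
       bracket L (D x) y + (-1) ^+ (a * b)%N *: bracket L x (D y)).

Definition superderivation (D : 'End(L)) : Prop :=
  exists D0 D1, [/\ superderivation_deg 0 D0, superderivation_deg 1 D1
                  & D = D0 + D1].

Definition trivial_superderivation (D : 'End(L)) : Prop := forall x, D x = 0.

Definition local_superderivation (Delta : 'End(L)) : Prop :=
  forall x, exists2 D, superderivation D & Delta x = D x.

Definition pure_local_superderivation (Delta : 'End(L)) : Prop :=
  local_superderivation Delta /\ ~ superderivation Delta.

End LieSuperalgebraTheory.

Arguments lcs {F} L k.
Arguments step_nilpotent {F} L n.

(* Main.v *)
(* Put N = n - 3 and choose k minimal with [L^(k+1), L^(N-k)] <> 0; such a k
   exists because k = N gives L^(n-1).  For homogeneous a_1, ..., a_k in L and v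
   in L^(N-k), let D = ad a_1 ... ad a_k ad v.  The obstructions to the Leibniz
   rule for D lie in the sum of the [L^(s+1), L^(N-s)] with s < k, which vanishes
   by minimality, so D is a superderivation, and it maps L^1 into L^(n-1), which
   is central.  Modulo the same vanishing brackets, the vectors D x with x in L^1
   span [L^(N-k), L^(k+1)], so some such D is nonzero on L^1.

   Let Delta be D composed with a linear projection onto L^1.  Any linear map
   with central values that kills L^1 is a superderivation, which settles the
   local condition at the points outside L^1; on L^1, Delta coincides with D.
   Conversely a superderivation with central values kills L^1, and Delta does
   not. *)
Require Import Defs.
From mathcomp Require Import all_boot all_order all_algebra.

Set Implicit Arguments.
Unset Strict Implicit.
Unset Printing Implicit Defensive.

Import GRing.Theory.
Local Open Scope ring_scope.

(** * Degrees and signs over Z_2 *)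

Lemma Z2_cases (a : 'Z_2) : a = 0 \/ a = 1.
Proof. by case: a => [[|[|//]] ?]; [left | right]; apply: val_inj. Qed.

Lemma Z2_1D1 : 1 + 1 = 0 :> 'Z_2.
Proof. exact: val_inj. Qed.

(** Reducing [a + b] modulo 2 changes the exponent by an even number only. *)
Lemma signr_Z2D (R : pzRingType) (a b c : 'Z_2) :
  (-1) ^+ ((a + b)%R * c)%N = (-1) ^+ (a * c)%N * (-1) ^+ (b * c)%N :> R.
Proof.
by case: (Z2_cases a) => ->; case: (Z2_cases b) => ->;
  case: (Z2_cases c) => -> /=; rewrite ?(expr0, expr1, mulr1, mul1r, mulrNN).
Qed.

Section LocalSuperderivation.

Variables (F : fieldType) (L : lieSuperalgebra F).

Local Notation "[ x , y ]" := (bracket L x y) (at level 0, x, y at level 99).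

Implicit Types (a b c : 'Z_2) (x y z : L) (U V W : {vspace L}).

(** * Homogeneous projections and graded subspaces *)

Definition hproj a : 'End(L) :=
  daddv_pi (part L a) (part L (a + 1)%R).

Lemma part_direct a : (part L a :&: part L (a + 1)%R = 0)%VS.
Proof.
case: (Z2_cases a) => ->; first by rewrite add0r part_cap.
by rewrite Z2_1D1 capvC part_cap.
Qed.

Lemma hproj_part a x : hproj a x \in part L a.
Proof. exact: memv_pi. Qed.

Lemma hproj_sum x : hproj 0 x + hproj 1 x = x.
Proof.
rewrite /hproj add0r Z2_1D1 daddv_pi_add ?part_cap //.
by rewrite part_sum memvf.
Qed.

Lemma hproj_id a x : x \in part L a -> hproj a x = x.
Proof. by move=> ax; rewrite /hproj daddv_pi_id // part_direct. Qed.

Lemma hproj_other a x : x \in part L a -> hproj (a + 1) x = 0.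
Proof.
move=> ax; have := hproj_sum x.
case: (Z2_cases a) ax => -> ax; rewrite ?add0r ?Z2_1D1 (hproj_id ax).
  by move=> /(canRL (addKr _)); rewrite addNr.
by move=> /(canRL (addrK _)); rewrite subrr.
Qed.

Definition graded V := forall a x, x \in V -> hproj a x \in V.

Lemma graded_full : graded fullv.
Proof. by move=> *; exact: memvf. Qed.

Lemma bracketv_sub_graded U V W : graded U -> graded V ->
  (forall a b x y, x \in U -> x \in part L a -> y \in V -> y \in part L b ->
     [x, y] \in W) ->
  (bracketv U V <= W)%VS.
Proof.
move=> gU gV UVW; apply/bracketv_subP => u v Uu Vv.
rewrite -(hproj_sum u) -(hproj_sum v) linearDl !linearDr /=.
by rewrite !memvD //; apply: (UVW _ _ _ _ (gU _ _ Uu) (hproj_part _ _)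
                                (gV _ _ Vv) (hproj_part _ _)).
Qed.

(** The bracket of homogeneous vectors is homogeneous, so [hproj a] either fixes it or kills it. *)
Lemma graded_bracketv U V : graded U -> graded V -> graded (bracketv U V).
Proof.
move=> gU gV a x; rewrite memv_preim; apply: subvP x.
apply: bracketv_sub_graded => // b c x y Ux bx Vy cy; rewrite -memv_preim.
have bxy := bracket_part bx cy.
have [->|->] : a = b + c \/ a = b + c + 1.
- by case: (Z2_cases a) => ->; case: (Z2_cases (b + c)) => ->;
    rewrite ?add0r ?Z2_1D1; auto.
- by rewrite hproj_id ?memv_bracket.
- by rewrite hproj_other ?mem0v.
Qed.

Lemma bracketvC U V : graded U -> graded V -> bracketv U V = bracketv V U.
Proof.
have sub U' V' : graded U' -> graded V' -> (bracketv U' V' <= bracketv V' U')%VS.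
  move=> gU gV; apply: bracketv_sub_graded => // a b x y Ux ax Vy By.
  by rewrite (bracket_skew ax By) memvN memvZ // memv_bracket.
by move=> gU gV; apply/eqP; rewrite eqEsubv !sub.
Qed.

Lemma bracketvSr U V W : (V <= W)%VS -> (bracketv U V <= bracketv U W)%VS.
Proof.
move=> sVW; apply/bracketv_subP => u v Uu Vv.
by rewrite memv_bracket // (subvP sVW).
Qed.


(** * Adjoint maps and the Jacobi identity for subspaces *)

Definition ad x : 'End(L) := linfun (bracket L x).

Lemma adE x y : ad x y = [x, y].
Proof. exact: lfunE. Qed.

(** Searching a finite basis and two degrees makes the witness constructive. The preimage under
    [ad x] leaves [V] intact, so the lemma can be iterated on nested brackets. *)
Lemma bracketv_subPn_homo U V W : graded U -> ~~ (bracketv U V <= W)%VS ->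
  exists a x, [/\ x \in U, x \in part L a & ~~ (V <= ad x @^-1: W)%VS].
Proof.
move=> gU nsub; have /hasP[u Uu /existsP[a nVW]] :
    has (fun u => [exists a, ~~ (V <= ad (hproj a u) @^-1: W)%VS]) (vbasis U).
  apply: contraR nsub => /hasPn none.
  apply/span_subvP => _ /allpairsP[[u v] /= [Uu Vv ->]].
  have /existsPn homo := none u Uu.
  by rewrite -(hproj_sum u) linearDl -!adE memvD // memv_preim;
    rewrite (subvP (negPn (homo _))) ?vbasis_mem.
by exists a, (hproj a u); rewrite hproj_part gU ?vbasis_mem.
Qed.

Lemma bracketv_subP_homo U V W : graded U ->
  (forall a x, x \in U -> x \in part L a -> (V <= ad x @^-1: W)%VS) ->
  (bracketv U V <= W)%VS.
Proof.
move=> gU adUV; apply/negPn/negP => /(bracketv_subPn_homo gU)[a [x [Ux ax]]].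
by rewrite (adUV a).
Qed.

(** Plays the role of the three subgroups lemma in the inductions below. *)
Lemma bracketv_jacobi U V W : graded U -> graded V ->
  (bracketv U (bracketv V W)
     <= bracketv (bracketv U V) W + bracketv V (bracketv U W))%VS.
Proof.
move=> gU gV; apply: bracketv_subP_homo => // a x Ux ax.
apply: bracketv_subP_homo => // b y Vy bY; apply/subvP => w Ww.
rewrite -!memv_preim !adE (bracket_jacobi _ ax bY).
by rewrite memv_add ?memvZ // !memv_bracket.
Qed.

(** * The lower central series *)

Lemma graded_lcs k : graded (lcs L k).
Proof.
elim: k => [|k IHk]; first exact: graded_full.
exact: graded_bracketv graded_full IHk.
Qed.

Arguments graded_lcs : clear implicits.

Lemma lcsS k : lcs L k.+1 = bracketv fullv (lcs L k).
Proof. by []. Qed.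

(** Induction on [i], by Jacobi on [L^j, [L, L^i]]. The successor is there because the series starts
    at L^0 = L. *)
Lemma bracketv_lcs i j : (bracketv (lcs L i) (lcs L j) <= lcs L (i + j)%N.+1)%VS.
Proof.
elim: i j => [|i IHi] j //.
rewrite (bracketvC (graded_lcs i.+1) (graded_lcs j)).
apply: subv_trans (bracketv_jacobi _ (graded_lcs j) graded_full) _.
rewrite subv_add; apply/andP; split.
  rewrite (bracketvC (graded_lcs j) graded_full) -lcsS.
  by rewrite (bracketvC (graded_lcs j.+1) (graded_lcs i)) addSnnS IHi.
rewrite (lcsS (i.+1 + j)%N) bracketvSr // addSn.
by rewrite (bracketvC (graded_lcs j) (graded_lcs i)) IHi.
Qed.

(** * Words in adjoint maps and their defect in the Leibniz rule *)

Inductive ad_word V : nat -> 'Z_2 -> 'End(L) -> Prop :=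
| ad_word0 a v : v \in part L a -> v \in V -> ad_word V 0 a (ad v)
| ad_wordS k a b x D : x \in part L a -> ad_word V k b D ->
    ad_word V k.+1 (a + b) (ad x \o D)%VF.

Lemma ad_word_part V k a D b x :
  ad_word V k a D -> x \in part L b -> D x \in part L (a + b).
Proof.
move=> VD; elim: VD b x => {k a D} [a v av _|k a c z D az _ IH] b x bx.
  by rewrite adE bracket_part.
by rewrite comp_lfunE adE -addrA bracket_part ?IH.
Qed.

Lemma ad_word_lcs r k a D j x :
  ad_word (lcs L r) k a D -> x \in lcs L j -> D x \in lcs L (r + k + j)%N.+1.
Proof.
move=> VD jx; elim: VD => {k a D} [a v av rv|k a c z D az _ IH].
  by rewrite adE addn0 (subvP (bracketv_lcs _ _)) ?memv_bracket.
by rewrite comp_lfunE adE addnS addSn lcsS memv_bracket ?memvf.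
Qed.

(* Holds the cross terms of a word in ad_word (lcs L r) k acting on [x, y]. *)
Definition cross_terms r k : {vspace L} :=
  (\sum_(s < k) bracketv (lcs L s.+1) (lcs L (r + k - s)%N))%VS.

(** By Jacobi, bracketing the summand of index [s] with L lands in the summands of index [s + 1] and
    [s] of the longer sum. *)
Lemma bracketv_cross_terms r k :
  (bracketv fullv (cross_terms r k) <= cross_terms r k.+1)%VS.
Proof.
apply: bracketv_subP_homo => [|a x _ _]; first exact: graded_full.
apply/subv_sumP => s _; apply/subvP => w sw; rewrite -memv_preim adE.
have := memv_bracket (memvf x) sw.
apply/subvP.
apply: subv_trans (bracketv_jacobi _ graded_full (graded_lcs s.+1)) _.
rewrite subv_add; apply/andP; split.
  apply: (sumv_sup (lift ord0 s)) => //.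
  by rewrite lift0 addnS subSS subvv.
apply: (sumv_sup (widen_ord (leqnSn k) s)) => //.
by rewrite -lcsS -subSn ?addnS //= (leq_trans (ltnW (ltn_ord s))) ?leq_addl.
Qed.

Lemma cross_terms_new r k :
  (bracketv (lcs L k.+1) (lcs L r.+1) <= cross_terms r k.+1)%VS.
Proof. by apply: (sumv_sup ord_max) => //=; rewrite addnS subSn ?leq_addl ?addnK. Qed.

Lemma cross_terms_first r k :
  (bracketv (lcs L 1) (lcs L (r + k)%N.+1) <= cross_terms r k.+1)%VS.
Proof. by apply: (sumv_sup ord0) => //=; rewrite addnS subn0. Qed.

(** Induction on the word: a single [ad v] satisfies the rule exactly, by Jacobi, and each further
    letter adds two mixed terms in [L^1, L^(r+k+1)]. *)
Lemma ad_word_leibniz r k a D b x y :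
  ad_word (lcs L r) k a D -> x \in part L b ->
  D [x, y] - ([D x, y] + (-1) ^+ (a * b)%N *: [x, D y]) \in cross_terms r k.
Proof.
move=> rD; elim: rD b x y => {k a D} [a v av _|k a c z D az rD IH] b x y bx.
  by rewrite !adE (bracket_jacobi _ av bx) subrr mem0v.
have [e Te De] : exists2 e, e \in cross_terms r k
    & D [x, y] = [D x, y] + (-1) ^+ (c * b)%N *: [x, D y] + e.
  by exists (D [x, y] - ([D x, y] + (-1) ^+ (c * b)%N *: [x, D y]));
    [apply: IH | rewrite addrC subrK].
rewrite !comp_lfunE !adE De !linearDr linearZr_LR /=.
rewrite (bracket_jacobi y az (ad_word_part rD bx)).
rewrite (bracket_jacobi (D y) az bx) scalerDr scalerA -signr_Z2D [(c + a)%R]addrC.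
(* [p] and [q] form the Leibniz rule for the longer word; [u] and [v] are the mixed terms, and [w]
   carries the earlier defect. *)
set p := [[z, D x], y]; set q := _ *: [x, _]; set u := _ *: [D x, _].
set v := _ *: [[z, x], _]; set w := [z, e].
have -> : p + u + (v + q) + w - (p + q) = u + v + w.
  by rewrite [p + u]addrC (addrACA u p) (addrAC _ w) addrK.
have cross1 x' y' : [z, x'] \in lcs L 1 /\ D y' \in lcs L (r + k)%N.+1.
  split; first by rewrite lcsS memv_bracket ?memvf.
  by have := ad_word_lcs rD (memvf y' : y' \in lcs L 0); rewrite addn0.
have [zx Dy] := cross1 x y; have [zy Dx] := cross1 y x.
rewrite !memvD //.
- apply/memvZ/(subvP (cross_terms_first r k)).
  by rewrite (bracketvC (graded_lcs 1) (graded_lcs _)) memv_bracket.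
- by apply/memvZ/(subvP (cross_terms_first r k)); rewrite memv_bracket.
- by apply/(subvP (bracketv_cross_terms r k)); rewrite memv_bracket ?memvf.
Qed.

(** * The values of words on L^1 *)

Fixpoint ad_words_image r k : {vspace L} :=
  if k is k'.+1 then bracketv fullv (ad_words_image r k')
  else bracketv (lcs L r) (lcs L 1).

(** Letters are peeled off one at a time, outermost first. [W] is arbitrary because each letter
    replaces it by its preimage. *)
Lemma ad_words_image_subPn r k W : ~~ (ad_words_image r k <= W)%VS ->
  exists a D x, [/\ ad_word (lcs L r) k a D, x \in lcs L 1 & D x \notin W].
Proof.
elim: k W => [|k IH] W /=.
  move=> /(bracketv_subPn_homo (graded_lcs r))[a [v [rv av /subvPn[x Lx]]]].
  by rewrite -memv_preim => nW; exists a, (ad v), x; split=> //; apply: ad_word0.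
move=> /(bracketv_subPn_homo graded_full)[a [z [_ az]]].
move=> /IH[b [D [x [rD Lx]]]]; rewrite -memv_preim -comp_lfunE => nW.
by exists (a + b), (ad z \o D)%VF, x; split=> //; apply: ad_wordS.
Qed.

(** Jacobi on [L^r, [L, L^(k+1)]] gives [L^(r+1), L^(k+1)], which is the last cross term, and [L,
    [L^r, L^(k+1)]], covered by induction. *)
Lemma bracketv_lcs_sub_ad_words_image r k :
  (bracketv (lcs L r) (lcs L k.+1) <= ad_words_image r k + cross_terms r k)%VS.
Proof.
elim: k => [|k IH]; first exact: addvSl.
apply: subv_trans (bracketv_jacobi _ (graded_lcs r) graded_full) _.
rewrite subv_add; apply/andP; split.
  rewrite (bracketvC (graded_lcs r) graded_full) -!lcsS.
  rewrite (bracketvC (graded_lcs _) (graded_lcs _)).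
  exact: subv_trans (cross_terms_new r k) (addvSr _ _).
apply: subv_trans (bracketvSr _ IH) _.
apply/bracketv_subP => x _ _ /memv_addP[u Eu [v Tv ->]].
rewrite linearDr memv_add ?memv_bracket ?memvf //.
by apply/(subvP (bracketv_cross_terms r k)); rewrite memv_bracket ?memvf.
Qed.

(** * The center is graded and two-sided *)

Lemma central_hproj a x : central x -> central (hproj a x).
Proof.
have part_eq0 b u v : u \in part L b -> v \in part L (b + 1)%R ->
    u + v = 0 -> u = 0.
  move=> bu bv /(canRL (addrK _)); rewrite sub0r => uE.
  by apply/eqP; rewrite -memv0 -(part_direct b) memv_cap bu uE memvN.
suff homo b y : y \in part L b -> central x -> [hproj a x, y] = 0.
  move=> cx y; rewrite -(hproj_sum y) linearDr /=.
  by rewrite !(homo _ _ (hproj_part _ _) cx) addr0.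
move=> yb /(_ y).
have -> : [x, y] = [hproj a x, y] + [hproj (a + 1) x, y].
  rewrite -linearDl /=; congr (bracket L _ y).
  by case: (Z2_cases a) => ->; rewrite ?add0r ?Z2_1D1 ?hproj_sum // addrC hproj_sum.
(* The two brackets have opposite degrees and sum to zero, so each vanishes. *)
apply: (part_eq0 (a + b)); first exact: bracket_part (hproj_part _ _) yb.
by rewrite addrAC (bracket_part (hproj_part _ _) yb).
Qed.

Lemma centralC x y : central x -> [y, x] = 0.
Proof.
move=> cx; rewrite -(hproj_sum x) -(hproj_sum y) linearDl !linearDr /=.
have homo a b : [hproj a y, hproj b x] = 0.
  by rewrite (bracket_skew (hproj_part _ _) (hproj_part _ _)) central_hproj
             ?scaler0 ?oppr0.
by rewrite !homo !addr0.
Qed.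

Lemma lcs_central k : lcs L k.+1 = 0%VS -> forall x, x \in lcs L k -> central x.
Proof.
move=> Lk0 x kx y; apply/eqP; rewrite -memv0 -Lk0 lcsS.
by rewrite (bracketvC graded_full (graded_lcs k)) memv_bracket ?memvf.
Qed.

(** * Superderivations with central values *)

Lemma superderivation_deg0 a : superderivation_deg a (0 : 'End(L)).
Proof.
split=> [b x _|b x y _]; first by rewrite lfunE mem0v.
by rewrite !lfunE /= linear0l linear0r scaler0 addr0.
Qed.

Lemma superderivation_of_deg a (D : 'End(L)) :
  superderivation_deg a D -> superderivation D.
Proof.
case: (Z2_cases a) => -> aD.
  by exists D, 0; rewrite addr0; split=> //; apply: superderivation_deg0.
by exists 0, D; rewrite add0r; split=> //; apply: superderivation_deg0.
Qed.

Lemma nilpotent_superderivation n : (3 <= n)%N -> step_nilpotent L n ->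
  exists (D : 'End(L)), [/\ superderivation D,
     forall x, x \in lcs L 1 -> central (D x)
   & exists2 x, x \in lcs L 1 & D x != 0].
Proof.
case: n => [|[|[|N]]] // _ [_ Ln0 min_n].
have [k brk min_k] : exists2 k,
    (k <= N)%N && (bracketv (lcs L k.+1) (lcs L (N - k)%N) != 0%VS)
  & forall s, (s < k)%N -> bracketv (lcs L s.+1) (lcs L (N - s)%N) = 0%VS.
  have exN : exists k,
      (k <= N)%N && (bracketv (lcs L k.+1) (lcs L (N - k)%N) != 0%VS).
    (* For [k = N] the bracket is L^(N+2) = L^(n-1), nonzero since [n] is the least index. *)
    exists N; rewrite leqnn subnn (bracketvC (graded_lcs _) graded_full).
    by rewrite -lcsS; apply/eqP => /(min_n N.+2 isT); rewrite ltnn.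
  case: (ex_minnP exN) => k kP min_k; exists k => // s sk.
  apply/eqP; apply: contraLR sk => brs; rewrite -leqNgt.
  (* Beyond [N] the subtraction [N - s] truncates to 0, but there [k <= N < s] suffices. *)
  have [sN|Ns] := leqP s N; first by rewrite min_k ?sN.
  by case/andP: kP => kN _; rewrite (leq_trans kN) // ltnW.
have [kN {}brk] := andP brk.
have rk : (N - k + k)%N = N by rewrite subnK.
have cross0 : cross_terms (N - k) k = 0%VS.
  by rewrite /cross_terms big1 // => s _; rewrite rk min_k.
have /ad_words_image_subPn[a [D [x [rD Lx Dx]]]] :
    ~~ (ad_words_image (N - k) k <= 0)%VS.
  apply: contra brk => Z; rewrite -subv0 (bracketvC (graded_lcs _) (graded_lcs _)).
  apply: subv_trans (bracketv_lcs_sub_ad_words_image _ _) _.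
  by rewrite cross0 addv0.
exists D; split.
- apply: (@superderivation_of_deg a); split=> [b y|b y z yb].
    exact: ad_word_part rD.
  apply/eqP; rewrite -subr_eq0 -memv0 -cross0.
  exact: ad_word_leibniz rD yb.
(* With [r = N - k], the word sends L^1 into L^(N+2), which is central because L^(N+3) = 0. *)
- move=> y /(ad_word_lcs rD); rewrite rk addn1.
  exact: lcs_central.
- by exists x; rewrite // -memv0.
Qed.

(** Every term of the Leibniz rule vanishes, for [f] and for its homogeneous components alike. *)
Lemma central_map_superderivation (f : 'End(L)) :
  (forall x, x \in lcs L 1 -> f x = 0) -> (forall x, central (f x)) ->
  superderivation f.
Proof.
move=> f0 cf.
(* [g a] is the component of [f] of degree [a]. *)
pose g a : 'End(L) :=
  (hproj a \o (f \o hproj 0))%VF + (hproj (a + 1) \o (f \o hproj 1))%VF.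
have gE a x : g a x = hproj a (f (hproj 0 x)) + hproj (a + 1)%R (f (hproj 1 x)).
  by rewrite add_lfunE !comp_lfunE.
have gL a x : x \in lcs L 1 -> g a x = 0.
  by move=> Lx; rewrite gE !f0 ?linear0 ?addr0 //; apply: graded_lcs.
have gZ a x y : [g a x, y] = 0.
  by rewrite gE linearDl /= !central_hproj ?addr0.
have gdeg a : superderivation_deg a (g a).
  split=> [b x bx|b x y bx].
    rewrite gE; case: (Z2_cases b) bx => -> bx.
      by have := hproj_other bx; rewrite add0r => ->;
        rewrite !linear0 !addr0 hproj_part.
    by have := hproj_other bx; rewrite Z2_1D1 => ->;
      rewrite !linear0 add0r hproj_part.
  rewrite gL ?gZ; last by rewrite lcsS memv_bracket ?memvf.
  rewrite centralC ?scaler0 ?addr0 // => z; exact: gZ.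
exists (g 0), (g 1); split=> //; apply/lfunP => x.
rewrite add_lfunE !gE Z2_1D1 add0r addrACA hproj_sum [_ + hproj 0 _]addrC hproj_sum.
by rewrite -linearD hproj_sum.
Qed.

(** On a homogeneous vector the even and odd parts of [f] take values in opposite degrees, so both
    values are central. The Leibniz rule for each part then gives zero on brackets. *)
Lemma central_superderivation_lcs1 (f : 'End(L)) : superderivation f ->
  (forall x, central (f x)) -> forall x, x \in lcs L 1 -> f x = 0.
Proof.
case=> D0 [D1 [[D0part D0L] [D1part D1L] ->]] cf x Lx.
have cD a y : y \in part L a -> central (D0 y) /\ central (D1 y).
  move=> ay; have := cf y; rewrite add_lfunE => cy.
  have ay0 := D0part _ _ ay; have ay1 := D1part _ _ ay.
  rewrite add0r in ay0; rewrite addrC in ay1.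
  have E b : hproj b (D0 y + D1 y) = hproj b (D0 y) + hproj b (D1 y).
    exact: linearD.
  split.
    have := central_hproj a cy; rewrite E (hproj_id ay0).
    have := hproj_other ay1; rewrite -addrA Z2_1D1 addr0 => ->.
    by rewrite addr0.
  by have := central_hproj (a + 1) cy; rewrite E (hproj_id ay1) hproj_other ?add0r.
apply/eqP; rewrite -memv0 memv_preim; apply: subvP x Lx.
apply: bracketv_subP_homo graded_full _ => a y _ ay; apply/subvP => z _.
rewrite -!memv_preim adE memv0 add_lfunE (D0L a) // (D1L a) //.
have [c0 c1] := cD a y ay.
rewrite c0 c1 !add0r.
have cDz (D : 'End(L)) : (forall b w, w \in part L b -> central (D w)) -> [y, D z] = 0 :> L.
  move=> cDw; rewrite -(hproj_sum z) linearD linearDr /=.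
  by rewrite !centralC ?addr0 //; apply: cDw (hproj_part _ _).
by rewrite !cDz ?scaler0 ?addr0 // => b w /cD[].
Qed.

(** * Maps into a line, and the pure local superderivation *)

Lemma separating_map W x y : x \notin W ->
  exists f : 'End(L), [/\ f x = y, forall w, w \in W -> f w = 0
    & forall z, f z \in <[y]>%VS].
Proof.
(* The map is [g], which kills [W] and sends [x] to [u], then the projection onto the line of [u],
   then [u] to [y]. *)
move=> nWx; pose u := x - projv W x; pose g := (\1 - projv W)%VF : 'End(L).
have gE z : g z = z - projv W z by rewrite !lfunE /= !lfunE.
have u0 : u != 0.
  by apply: contra nWx => /eqP/subr0_eq->; apply: memv_proj.
have [h hu] := linear_of_free [:: u] [:: y].
have {hu}[hu] : map h [:: u] = [:: y] by rewrite hu // seq1_free.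
exists (linfun h \o projv <[u]> \o g)%VF; split.
- by rewrite !comp_lfunE gE -/u (projv_id (memv_line u)) lfunE.
- by move=> w Ww; rewrite !comp_lfunE gE projv_id // subrr !linear0.
- move=> z; rewrite !comp_lfunE.
  have /vlineP[c ->] := memv_proj <[u]>%VS (g z).
  by rewrite linearZ /= lfunE /= hu memvZ ?memv_line.
Qed.

End LocalSuperderivation.

Theorem theorem4p1 (F : fieldType) (L : lieSuperalgebra F) (n : nat)
  (hn : (3 <= n)%N) (hL : step_nilpotent L n)
  (hD : exists D : 'End(L),
      [/\ superderivation D, ~ trivial_superderivation D
        & forall x : L, x \in lcs L 1 -> central (D x)]) :
  exists Delta : 'End(L), pure_local_superderivation Delta.
Proof.
have [D [sD cD [x Lx Dx]]] := nilpotent_superderivation hn hL.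
(* The values of [D] are known to be central only on L^1; projecting first makes them central
   everywhere. *)
pose Delta := (D \o projv (lcs L 1))%VF.
have cDelta y : central (Delta y) by rewrite comp_lfunE; apply/cD/memv_proj.
exists Delta; split=> [y | sDelta].
  have [Ly | nLy] := boolP (y \in lcs L 1).
    by exists D; rewrite // comp_lfunE projv_id.
  (* All values of [f] are multiples of the central vector [Delta y], and [f] kills L^1, so [f] is a
     superderivation. *)
  have [f [fy fL fDy]] := separating_map (Delta y) nLy.
  exists f; last by rewrite fy.
  apply: central_map_superderivation => // z w.
  by have /vlineP[c ->] := fDy z; rewrite linearZl_LR cDelta scaler0.
have := central_superderivation_lcs1 sDelta cDelta Lx.
by rewrite comp_lfunE projv_id // => /eqP; rewrite (negPf Dx).
Qed.
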